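(* For any hypergraph $H$ and any $B\subseteq V(\mathrm{core}(H))$, $B$ is a lazy burning set for $\mathrm{core}(H)$ if and only if $B$ is a lazy burning set for $H$.
   Context: A hypergraph $H$ consists of a finite vertex set $V(H)$ and a finite collection $E(H)$ of nonempty subsets of $V(H)$. Lazy burning: a set $B\subseteq V(H)$ is burned initially; in each subsequent round every unburned vertex $v$ for which some hyperedge $h\ni v$ has $h\setminus\{v\}$ entirely burned becomes burned. $B$ is a lazy burning set if eventually all vertices burn. For $U\subseteq V(H)$, $H[U]$ has vertex set $U$ and hyperedges $\{h\cap U: h\in E(H),\ h\cap U\neq\emptyset\}$. The core $\mathrm{core}(H)$ is $H[U]$ for the largest $U\subseteq V(H)$ such that every hyperedge of $H[U]$ has cardinality at least $2$ (equivalently, obtained by repeatedly deleting the vertex of a singleton hyperedge until none remain). *)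

(* Defs.v *)
From mathcomp Require Import all_boot.

Set Implicit Arguments.
Unset Strict Implicit.
Unset Printing Implicit Defensive.

(* The vertices are drawn from an ambient finite type T, so that H and its
   induced subhypergraphs live over the same type; the vertex set V(H) may be
   any subset of T, possibly empty. *)
Record hypergraph (T : finType) := Hypergraph {
  vertices : {set T};
  edges : {set {set T}};
  edges_sub : forall h, h \in edges -> h \subset vertices;
  edges_neq0 : forall h, h \in edges -> h != set0
}.

Section Burning.
Variables (T : finType) (H : hypergraph T).

(* A singleton edge {v} burns v unconditionally, since {v} :\ v is empty. *)
Definition burn_step (A : {set T}) : {set T} :=
  A :|: [set v in vertices H :\: A |
          [exists h in edges H, (v \in h) && (h :\ v \subset A)]].

Definition burned (B : {set T}) (t : nat) : {set T} := iter t burn_step B.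

Definition lazy_burning_set (B : {set T}) : Prop :=
  B \subset vertices H /\ exists t : nat, vertices H \subset burned B t.

End Burning.

Section Induced.
Variables (T : finType) (H : hypergraph T).

Definition induced_edges (U : {set T}) : {set {set T}} :=
  [set h :&: U | h in edges H & h :&: U != set0].

Lemma induced_edges_sub U h : h \in induced_edges U -> h \subset U.
Proof. by case/imsetP=> h' _ ->; apply: subsetIr. Qed.

Lemma induced_edges_neq0 U h : h \in induced_edges U -> h != set0.
Proof. by case/imsetP=> h'; rewrite inE => /andP[_ ?] ->. Qed.

(* Only used for U \subset vertices H. *)
Definition induced (U : {set T}) : hypergraph T :=
  Hypergraph (@induced_edges_sub U) (@induced_edges_neq0 U).

Definition no_singleton_edge (U : {set T}) : bool :=
  [forall h in edges (induced U), 2 <= #|h|].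

(* The union of all admissible U; core_vertices_largest states that it is
   itself admissible, hence the largest admissible set. *)
Definition core_vertices : {set T} :=
  \bigcup_(U : {set T} | (U \subset vertices H) && no_singleton_edge U) U.

Lemma core_vertices_largest :
  [/\ core_vertices \subset vertices H, no_singleton_edge core_vertices
    & forall U : {set T}, U \subset vertices H -> no_singleton_edge U ->
        U \subset core_vertices].
Proof.
split=> [||U sU nU].
- by apply/bigcupsP => U /andP[].
- apply/forall_inP => k /imsetP[h]; rewrite inE => /andP[hE /set0Pn[x]].
  rewrite inE => /andP[xh /bigcupP[U gU xU]] ->.
  have /andP[_ /forall_inP nU] := gU.
  apply: (@leq_trans #|h :&: U|).
    apply/nU/imsetP; exists h => //; rewrite inE hE.
    by apply/set0Pn; exists x; rewrite inE xh.
  exact/subset_leq_card/setIS/bigcup_sup.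
- by apply: bigcup_sup; rewrite sU.
Qed.

Definition core : hypergraph T := induced core_vertices.

End Induced.

(* Main.v *)
(* Lazy burning from B succeeds iff every burn-closed set containing B contains
   all vertices.  Let C be the vertex set of the core.  If A is burn-closed in H,
   then C :|: (V(H) \ A) induces no singleton edge, so it lies in C by
   maximality; that is, A contains V(H) \ C.  Moreover, A is burn-closed in
   core(H) iff A :|: (V(H) \ C) is burn-closed in H. *)
Require Import Defs.
From mathcomp Require Import all_boot.

Set Implicit Arguments.
Unset Strict Implicit.
Unset Printing Implicit Defensive.

Section BurnClosed.
Variables (T : finType) (H : hypergraph T).

Definition burn_closed (A : {set T}) : Prop :=
  forall v h, h \in edges H -> v \in h -> h :\ v \subset A -> v \in A.

Lemma burn_stepP (A : {set T}) v :
  reflect (v \in A \/ exists h, [/\ h \in edges H, v \in h & h :\ v \subset A])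
          (v \in burn_step H A).
Proof.
rewrite in_setU !inE; have [vA|vNA] /= := boolP (v \in A).
  by apply: ReflectT; left.
apply: (iffP andP) => [[_ /exists_inP[h hE /andP[vh hA]]]|[//|[h [hE vh hA]]]].
  by right; exists h.
split; first exact: subsetP (edges_sub hE) _ vh.
by apply/exists_inP; exists h; rewrite ?vh.
Qed.

Lemma burn_stepS : {homo burn_step H : A A' / A \subset A'}.
Proof.
move=> A A' sA; apply/subsetP => v /burn_stepP[vA|[h [hE vh hA]]].
  by apply/burn_stepP; left; apply: (subsetP sA).
by apply/burn_stepP; right; exists h; split=> //; apply: subset_trans sA.
Qed.

Lemma burned_min (A B : {set T}) t :
  B \subset A -> burn_closed A -> burned H B t \subset A.
Proof.
move=> sBA clA; elim: t => // t IHt; apply/subsetP => v.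
case/burn_stepP=> [|[h [hE vh hA]]]; first exact: (subsetP IHt).
exact: clA hE vh (subset_trans hA IHt).
Qed.

(** The witness is the least fixed point of [F]. Since [fixset] iterates from the empty set, [F]
    adjoins [B] at every step so that the limit contains [B]. *)
Lemma burn_closed_burned (B : {set T}) :
  exists2 A : {set T}, B \subset A /\ burn_closed A & exists t, A \subset burned H B t.
Proof.
pose F A := B :|: burn_step H A.
have homoF : {homo F : A A' / A \subset A'}.
  by move=> A A' sA; apply/setUS/burn_stepS.
have FK : F (fixset F) = fixset F by apply: fixsetK.
exists (fixset F); first split.
- by rewrite -FK subsetUl.
- move=> v h hE vh hA; rewrite -FK inE; apply/orP; right.
  by apply/burn_stepP; right; exists h.
(* [fixset F] is the [#|T|]-th iterate of [F] from [set0], and by induction each such iterate lies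
   below the same iterate of [burn_step] from [B]. *)
- exists #|T|; rewrite /fixset /burned.
  elim: #|T| => [|n IHn]; first exact: sub0set.
  rewrite !iterS subUset (burn_stepS IHn) andbT -iterS.
  by elim: n.+1 => //= m IHm; apply: subset_trans IHm (subsetUl _ _).
Qed.

Lemma lazy_burning_setP (B : {set T}) :
  lazy_burning_set H B <->
  B \subset vertices H /\
  forall A : {set T}, B \subset A -> burn_closed A -> vertices H \subset A.
Proof.
split=> -[sBV burnB]; split=> //.
  case: burnB => t sVt A sBA clA.
  exact: subset_trans sVt (burned_min t sBA clA).
have [A [sBA clA] [t sAt]] := burn_closed_burned B.
by exists t; apply: subset_trans (burnB A sBA clA) sAt.
Qed.

(** Quantifying over edges of [H] is harmless: an edge disjoint from [U] has an empty trace, which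
    is no singleton. *)
Lemma no_singleton_edgeP (U : {set T}) :
  reflect (forall h v, h \in edges H -> h :&: U != [set v])
          (no_singleton_edge H U).
Proof.
apply: (iffP forall_inP) => [nU h v hE|nU _ /imsetP[h + ->]].
  apply/eqP => hU; have /nU: [set v] \in edges (induced H U).
    apply/imsetP; exists h; rewrite ?hU // inE hE hU.
    by apply/set0Pn; exists v; rewrite set11.
  by rewrite cards1.
rewrite inE -card_gt0 => /andP[hE hU0]; rewrite ltn_neqAle hU0 andbT.
by rewrite eq_sym; apply/cards1P => -[v /eqP]; rewrite (negPf (nU h v hE)).
Qed.

Lemma burn_closed_noncore (A : {set T}) :
  burn_closed A -> vertices H :\: core_vertices H \subset A.
Proof.
move=> clA; have [sCV /no_singleton_edgeP nC maxC] := core_vertices_largest H.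
pose U := core_vertices H :|: vertices H :\: A.
have sUC : U \subset core_vertices H.
  apply: maxC; first by rewrite subUset sCV subsetDl.
  apply/no_singleton_edgeP => h v hE; apply/eqP => hU.
  have hUE x : x \in h -> x \in U -> x = v.
    by move=> xh xU; apply/set1P; rewrite -hU inE xh.
  have /setIP[vh vU] : v \in h :&: U by rewrite hU set11.
  case/setUP: vU => [vC|/setDP[_ /negP[]]].
    (* If [v] is in the core, [h] meets the core in [v] alone, against [nC]. *)
    case/eqP: (nC h v hE); apply/setP => x; rewrite !inE.
    apply/andP/eqP => [[xh xC]|->//].
    by apply: hUE; rewrite // inE xC.
  (* Otherwise [v] is outside [A]. Any vertex of [h] outside [A] lies in [U], hence equals [v], so
     [h] burns [v] from [A]. *)
  apply: (clA v h) => //; apply/subsetP => x /setD1P[/eqP xv xh].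
  apply/negPn/negP => xA; apply: xv; apply: hUE => //.
  by rewrite !inE xA (subsetP (edges_sub hE)) ?orbT.
apply/subsetP => v /setDP[vV vNC]; apply: contraNT vNC => vNA.
by apply: (subsetP sUC); rewrite !inE vNA vV orbT.
Qed.

End BurnClosed.

(** Adjoining the vertices outside [U] makes the part of an edge [h] outside [U] count as burned:
    for [v] in [U], [h :\ v] lies in the enlarged set exactly when [(h :&: U) :\ v] lies in [A]. *)
Lemma burn_closed_induced (T : finType) (H : hypergraph T) (U A : {set T}) :
  burn_closed (induced H U) A <->
  burn_closed H (A :|: (vertices H :\: U)).
Proof.
split=> clA v h.
  move=> hE vh hA; have vV := subsetP (edges_sub hE) v vh.
  rewrite !inE vV andbT; have [vU /=|//] := boolP (v \in U); last by rewrite orbT.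
  have vhU : v \in h :&: U by rewrite inE vh.
  rewrite orbF; apply: (clA v (h :&: U)) => //.
    by apply/imsetP; exists h; rewrite // inE hE; apply/set0Pn; exists v.
  apply/subsetP => x; rewrite !inE => /and3P[xv xh xU].
  have /(subsetP hA) : x \in h :\ v by rewrite !inE xv.
  by rewrite !inE xU orbF.
case/imsetP=> k; rewrite inE => /andP[kE _] -> /setIP[vk vU] kA.
have := clA v k kE vk; rewrite !inE vU orbF; apply.
apply/subsetP => x /setD1P[xv xk]; rewrite !inE (subsetP (edges_sub kE)) // andbT.
have [xU|_] := boolP (x \in U); last by rewrite orbT.
by rewrite (subsetP kA) // !inE xv xk.
Qed.

Theorem theorem3p6 (T : finType) (H : hypergraph T) (B : {set T})
    (hB : B \subset vertices (core H)) :
  lazy_burning_set (core H) B <-> lazy_burning_set H B.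
Proof.
have [sCV _ _] := core_vertices_largest H.
split=> /lazy_burning_setP[_ burnB]; apply/lazy_burning_setP; split=> //.
- exact: subset_trans sCV.
- move=> A sBA clA; have sNCA := burn_closed_noncore clA.
  (* As [A] already contains all vertices outside the core, adjoining them changes nothing, so [A]
     itself is burn-closed in the core. *)
  have sCA : core_vertices H \subset A.
    apply: burnB => //; apply/burn_closed_induced.
    by rewrite (setUidPl sNCA).
  apply/subsetP => v vV.
  have [/(subsetP sCA)//|vNC] := boolP (v \in core_vertices H).
  by apply: (subsetP sNCA); rewrite inE vNC.
- move=> A sBA /burn_closed_induced clA.
  (* The enlarged set contains every vertex of [H]; a core vertex can only come from its part
     [A]. *)
  have /subsetP sVA := burnB _ (subset_trans sBA (subsetUl _ _)) clA.
  apply/subsetP => v vC; have := sVA v (subsetP sCV v vC).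
  by rewrite in_setU in_setD vC orbF.
Qed.
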